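(* Let $S\in\mathbb{R}^{n\times n}$ be symmetric with zero diagonal, $\mu\in\mathbb{R}^n$, and $E(\mathbf{v})=-\tfrac12\mathbf{v}^{\mathsf T}S\mathbf{v}-\mu\cdot\mathbf{v}$ for $\mathbf{v}\in\{-1,1\}^n$. Let $H\subset\{1,\dots,n\}$, $Q=H^c$, and fix $\mathbf{v}_H\in\{-1,1\}^{|H|}$. For every $\mathbf{v}_Q\in\{-1,1\}^{|Q|}$, with $\mathbf{v}=(\mathbf{v}_Q,\mathbf{v}_H)\in\{-1,1\}^n$, $$E(\mathbf{v})=-\tfrac12\mathbf{v}_Q^{\mathsf T}S_{QQ}\mathbf{v}_Q-\mu_{\mathrm{eff}}\cdot\mathbf{v}_Q+C_H(\mathbf{v}_H),$$ where $\mu_{\mathrm{eff}}=\mu_Q+S_{QH}\mathbf{v}_H$ and $C_H(\mathbf{v}_H)=-\tfrac12\mathbf{v}_H^{\mathsf T}S_{HH}\mathbf{v}_H-\mu_H\cdot\mathbf{v}_H$. Consequently, under the constraint that the spins on $H$ are fixed at $\mathbf{v}_H$, minimizing $E$ over $\mathbf{v}\in\{-1,1\}^n$ is equivalent to minimizing $E_Q(\mathbf{v}_Q)=-\tfrac12\mathbf{v}_Q^{\mathsf T}S_{QQ}\mathbf{v}_Q-\mu_{\mathrm{eff}}\cdot\mathbf{v}_Q$ over $\mathbf{v}_Q\in\{-1,1\}^{|Q|}$.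
   Context: $S_{QQ},S_{QH},S_{HH}$ and $\mu_Q,\mu_H$ denote the submatrices and subvectors indexed by the sets shown; $(\mathbf{v}_Q,\mathbf{v}_H)$ is the vector whose restrictions to $Q$ and $H$ are $\mathbf{v}_Q$ and $\mathbf{v}_H$. *)

(* Defs.v *)
From mathcomp Require Import all_boot all_order all_algebra.
From mathcomp Require Import reals.

Set Implicit Arguments.
Unset Strict Implicit.
Unset Printing Implicit Defensive.

Import Order.TTheory GRing.Theory Num.Theory.
Local Open Scope ring_scope.

Definition spin (R : realType) (n : nat) (v : 'cV[R]_n) : Prop :=
  forall i, v i 0 = -1 \/ v i 0 = 1.

(* A subset A of 'I_n is listed in increasing order by enum_val : 'I_#|A| -> 'I_n,
   so vectors and matrices indexed by A have size #|A|. *)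
Definition restr (R : realType) (n : nat) (A : {set 'I_n}) (v : 'cV[R]_n) :
    'cV[R]_#|A| :=
  \col_k v (enum_val k) 0.

Definition submatrix (R : realType) (n : nat) (A B : {set 'I_n}) (S : 'M[R]_n) :
    'M[R]_(#|A|, #|B|) :=
  mxsub (@enum_val _ (mem A)) (@enum_val _ (mem B)) S.

Lemma notin_setC (n : nat) (H : {set 'I_n}) (i : 'I_n) :
  ~ i \in H -> i \in ~: H.
Proof. by rewrite in_setC => /negP. Qed.

(* The vector with restriction vQ to the complement of H and vH to H;
   see restr_glueQ, restr_glueH and glue_restr. *)
Definition glue (R : realType) (n : nat) (H : {set 'I_n})
    (vQ : 'cV[R]_#|~: H|) (vH : 'cV[R]_#|H|) : 'cV[R]_n :=
  \col_i match decP (@idP (i \in H)) with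
         | left iH => vH (enum_rank_in iH i) 0
         | right iQ => vQ (enum_rank_in (notin_setC iQ) i) 0
         end.

Lemma restr_glueH (R : realType) (n : nat) (H : {set 'I_n})
    (vQ : 'cV[R]_#|~: H|) (vH : 'cV[R]_#|H|) :
  restr H (glue vQ vH) = vH.
Proof.
apply/colP => k; rewrite !mxE; case: (decP _) => iH.
  by rewrite enum_valK_in.
by case: iH; apply: enum_valP.
Qed.

Lemma restr_glueQ (R : realType) (n : nat) (H : {set 'I_n})
    (vQ : 'cV[R]_#|~: H|) (vH : 'cV[R]_#|H|) :
  restr (~: H) (glue vQ vH) = vQ.
Proof.
apply/colP => k; rewrite !mxE; case: (decP _) => iH.
  by have := enum_valP k; rewrite in_setC iH.
by rewrite enum_valK_in.
Qed.

Lemma glue_restr (R : realType) (n : nat) (H : {set 'I_n}) (v : 'cV[R]_n) :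
  glue (restr (~: H) v) (restr H v) = v.
Proof.
apply/colP => i; rewrite !mxE; case: (decP _) => iH; rewrite mxE.
  by rewrite enum_rankK_in.
by rewrite enum_rankK_in // notin_setC.
Qed.

Definition energy (R : realType) (n : nat) (S : 'M[R]_n) (mu v : 'cV[R]_n) : R :=
  - (1 / 2) * (v^T *m S *m v) 0 0 - (mu^T *m v) 0 0.

Definition mu_eff (R : realType) (n : nat) (S : 'M[R]_n) (mu : 'cV[R]_n)
    (H : {set 'I_n}) (vH : 'cV[R]_#|H|) : 'cV[R]_#|~: H| :=
  restr (~: H) mu + submatrix (~: H) H S *m vH.

Definition C_H (R : realType) (n : nat) (S : 'M[R]_n) (mu : 'cV[R]_n)
    (H : {set 'I_n}) (vH : 'cV[R]_#|H|) : R :=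
  - (1 / 2) * (vH^T *m submatrix H H S *m vH) 0 0 - ((restr H mu)^T *m vH) 0 0.

Definition E_Q (R : realType) (n : nat) (S : 'M[R]_n) (mu : 'cV[R]_n)
    (H : {set 'I_n}) (vH : 'cV[R]_#|H|) (vQ : 'cV[R]_#|~: H|) : R :=
  - (1 / 2) * (vQ^T *m submatrix (~: H) (~: H) S *m vQ) 0 0
  - ((mu_eff S mu vH)^T *m vQ) 0 0.

Definition minimizer (R : realType) (T : Type) (f : T -> R) (P : T -> Prop)
    (x : T) : Prop :=
  P x /\ forall y, P y -> f x <= f y.

(* Main.v *)
Require Import Defs.
From mathcomp Require Import all_boot all_order all_algebra reals.
From mathcomp Require Import ring.

Set Implicit Arguments.
Unset Strict Implicit.
Unset Printing Implicit Defensive.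

Import Order.TTheory GRing.Theory Num.Theory.
Local Open Scope ring_scope.

(** Splitting every index sum along H and its complement Q ([sum_setC_enum_val]) breaks v^T S v into
    four blocks and mu . v into two. The QQ block stays, the HH block and mu_H . v_H form the
    constant [C_H], and symmetry of S merges the two cross blocks into a term linear in v_Q, the
    field that [mu_eff] adds to mu_Q; this is [energy_glue]. Gluing is a bijection from spin vectors
    on Q onto the spin vectors equal to v_H on H, and a constant shift preserves minimizers, whence
    [minimizer_glue]. *)

Lemma sum_setC_enum_val (V : nmodType) (n : nat) (A : {set 'I_n})
    (F : 'I_n -> V) :
  \sum_i F i =
    \sum_(k < #|A|) F (enum_val k) + \sum_(k < #|~: A|) F (enum_val k).
Proof.
rewrite (bigID (mem A)) /=; congr (_ + _); first exact: big_enum_val.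
rewrite -(@big_enum_val _ _ _ _ (mem (~: A)) F) /=.
by apply: eq_bigl => i; rewrite in_setC.
Qed.

Lemma dot_restr (R : realType) (n : nat) (A : {set 'I_n}) (u v : 'cV[R]_n) :
  u^T *m v =
    (restr A u)^T *m restr A v + (restr (~: A) u)^T *m restr (~: A) v.
Proof.
apply/matrixP => i j; rewrite !mxE (sum_setC_enum_val A).
by congr (_ + _); apply: eq_bigr => k _; rewrite !mxE !ord1.
Qed.

Lemma restr_mulmx (R : realType) (n : nat) (A B : {set 'I_n}) (S : 'M[R]_n)
    (v : 'cV[R]_n) :
  restr A (S *m v) =
    submatrix A B S *m restr B v + submatrix A (~: B) S *m restr (~: B) v.
Proof.
apply/colP => i; rewrite !mxE (sum_setC_enum_val B).
by congr (_ + _); apply: eq_bigr => k _; rewrite !mxE.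
Qed.

Lemma tr_submatrix (R : realType) (n : nat) (A B : {set 'I_n}) (S : 'M[R]_n) :
  (submatrix A B S)^T = submatrix B A S^T.
Proof. by apply/matrixP => i j; rewrite !mxE. Qed.

Lemma energy_glue (R : realType) (n : nat) (S : 'M[R]_n) (mu : 'cV[R]_n)
    (H : {set 'I_n}) (vQ : 'cV[R]_#|~: H|) (vH : 'cV[R]_#|H|) :
  S^T = S -> energy S mu (glue vQ vH) = E_Q S mu vH vQ + C_H S mu vH.
Proof.
(* Reading v^T S v as the dot product of v with S v lets [dot_restr] split the quadratic and the
   linear term alike. *)
move=> S_sym; rewrite /energy /E_Q /C_H /mu_eff -mulmxA !(dot_restr H).
rewrite !(restr_mulmx _ H) !restr_glueH !restr_glueQ.
(* On the right-hand side, the transpose of S_QH v_H inside [mu_eff] becomes v_H^T S_HQ, the same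
   shape as one of the cross blocks of the energy. *)
rewrite [(_ + _)^T]linearD /= mulmxDl !mulmxDr !mulmxA trmx_mul.
rewrite tr_submatrix S_sym.
(* By symmetry of S the two cross terms are equal, which absorbs the factor 1/2. *)
have cross : (vQ^T *m submatrix (~: H) H S *m vH) 0 0 =
             (vH^T *m submatrix H (~: H) S *m vQ) 0 0.
  have <- : (vQ^T *m submatrix (~: H) H S *m vH)^T =
            vH^T *m submatrix H (~: H) S *m vQ.
    by rewrite !trmx_mul trmxK tr_submatrix S_sym mulmxA.
  by rewrite [RHS]mxE.
by rewrite ![(_ + _ : 'M_(_, _)) 0 0]mxE cross; field.
Qed.

Lemma spin_restr (R : realType) (n : nat) (A : {set 'I_n}) (v : 'cV[R]_n) :
  spin v -> spin (restr A v).
Proof. by move=> v_spin k; rewrite mxE. Qed.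

Lemma spin_glue (R : realType) (n : nat) (H : {set 'I_n})
    (vQ : 'cV[R]_#|~: H|) (vH : 'cV[R]_#|H|) :
  spin vQ -> spin vH -> spin (glue vQ vH).
Proof. by move=> vQ_spin vH_spin i; rewrite mxE; case: (decP _). Qed.

Lemma minimizer_glue (R : realType) (n : nat) (S : 'M[R]_n) (mu : 'cV[R]_n)
    (H : {set 'I_n}) (vQ : 'cV[R]_#|~: H|) (vH : 'cV[R]_#|H|) :
  S^T = S -> spin vH ->
  minimizer (E_Q S mu vH) (@spin R #|~: H|) vQ <->
  minimizer (energy S mu) (fun v => spin v /\ restr H v = vH) (glue vQ vH).
Proof.
move=> S_sym vH_spin; split=> [[vQ_spin vQ_min]|[[v_spin _] v_min]].
  split; first by split; [exact: spin_glue | exact: restr_glueH].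
  (* Every competitor v is itself glued from its restrictions, so [C_H] occurs on both sides and
     cancels. *)
  move=> v [v_spin v_H]; rewrite -(glue_restr H v) v_H !energy_glue // lerD2r.
  exact/vQ_min/spin_restr.
split; first by rewrite -(restr_glueQ vQ vH); exact: spin_restr.
move=> wQ wQ_spin; rewrite -(lerD2r (C_H S mu vH)) -!energy_glue //.
by apply: v_min; split; [exact: spin_glue | exact: restr_glueH].
Qed.

Theorem theoremA9 (R : realType) (n : nat) (S : 'M[R]_n) (mu : 'cV[R]_n)
    (S_sym : S^T = S) (S_diag : forall i, S i i = 0)
    (H : {set 'I_n}) (vH : 'cV[R]_#|H|) (vH_spin : spin vH) :
  (forall vQ : 'cV[R]_#|~: H|, spin vQ ->
     spin (glue vQ vH) /\
     energy S mu (glue vQ vH) =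
       - (1 / 2) * (vQ^T *m submatrix (~: H) (~: H) S *m vQ) 0 0
       - ((mu_eff S mu vH)^T *m vQ) 0 0
       + C_H S mu vH)
  /\ (forall vQ : 'cV[R]_#|~: H|,
        minimizer (E_Q S mu vH) (@spin R #|~: H|) vQ <->
        minimizer (energy S mu) (fun v => spin v /\ restr H v = vH) (glue vQ vH))
  /\ (forall v : 'cV[R]_n,
        minimizer (energy S mu) (fun v => spin v /\ restr H v = vH) v <->
        exists2 vQ : 'cV[R]_#|~: H|,
          minimizer (E_Q S mu vH) (@spin R #|~: H|) vQ & v = glue vQ vH).
Proof.
split=> [vQ vQ_spin|]; first by split; [exact: spin_glue | exact: energy_glue].
split=> [vQ|v]; first exact: minimizer_glue.
split=> [v_min|[vQ vQ_min ->]]; last exact/minimizer_glue.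
have [[_ v_H] _] := v_min.
(* The constraint on H makes any minimizer a glued vector, which reduces the claim to
   [minimizer_glue]. *)
have v_glue : v = glue (restr (~: H) v) vH by rewrite -v_H glue_restr.
by exists (restr (~: H) v) => //; apply/minimizer_glue => //; rewrite -v_glue.
Qed.
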